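(* The equivalence relation $\Delta_{\mathbb{R}}^+$ is Borel reducible to the topological conjugacy relation $\cong_{tc}$ on the standard Borel space $\mathcal{M}_{2^{\mathbb{N}}}$ of Cantor minimal systems. That is, there is a Borel map $f:\mathbb{R}^{\mathbb{N}}\to\mathcal{M}_{2^{\mathbb{N}}}$ such that for all $x,y\in\mathbb{R}^{\mathbb{N}}$, $\{x_i:i\in\mathbb{N}\}=\{y_i:i\in\mathbb{N}\}$ if and only if $f(x)\cong_{tc}f(y)$.
   Context: A Cantor minimal system is a pair $(X,\varphi)$ where $X$ is a Cantor space and $\varphi:X\to X$ is a homeomorphism with no non-empty proper closed $\varphi$-invariant subsets. Two such systems $(X,\varphi)$, $(Y,\psi)$ are topologically conjugate if there is a homeomorphism $\pi:X\to Y$ with $\pi\circ\varphi=\psi\circ\pi$. Let $\mathbb{B}$ be the countable Boolean algebra of clopen subsets of $2^{\mathbb{N}}$; the homeomorphism group $H(2^{\mathbb{N}})$ is identified with $\mathrm{Aut}(\mathbb{B})$ (via $\varphi\mapsto(U\mapsto\varphi[U])$), a $G_\delta$ subset of the Polish space $\mathbb{B}^{\mathbb{B}}$, hence Polish. $\mathcal{M}_{2^{\mathbb{N}}}$ is the (Borel) subset of $H(2^{\mathbb{N}})$ consisting of minimal homeomorphisms, with the induced standard Borel structure, and $\cong_{tc}$ is topological conjugacy on it. $\Delta_{\mathbb{R}}^+$ is the equivalence relation on $\mathbb{R}^{\mathbb{N}}$ given by $x\,\Delta_{\mathbb{R}}^+\,y\iff\{x_i:i\in\mathbb{N}\}=\{y_i:i\in\mathbb{N}\}$.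 For equivalence relations $E,F$ on standard Borel spaces $X,Y$, $E$ is Borel reducible to $F$ if there is a Borel $f:X\to Y$ with $x\,E\,y\iff f(x)\,F\,f(y)$. *)

(* Defs.v *)
From HB Require Import structures.
From mathcomp Require Import all_boot all_order all_algebra.
From mathcomp Require Import all_classical all_reals all_analysis.

Set Implicit Arguments.
Unset Strict Implicit.
Unset Printing Implicit Defensive.

Import Order.TTheory GRing.Theory Num.Theory.
Import numFieldNormedType.Exports.

Local Open Scope classical_set_scope.

Definition borel (X : topologicalType) : set (set X) := <<s @open X >>.
Arguments borel : clear implicits.

Definition borel_map (X Y : topologicalType) (f : X -> Y) : Prop :=
  forall A : set Y, borel Y A -> borel X (f @^-1` A).

Definition borel_reducible (X Y : topologicalType)
    (E : X -> X -> Prop) (F : Y -> Y -> Prop) : Prop :=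
  exists2 f : X -> Y, borel_map f & forall x y : X, E x y <-> F (f x) (f y).

Definition homeomorphism (X Y : topologicalType) (h : X -> Y) : Prop :=
  continuous h /\
  exists g : Y -> X, [/\ continuous g, cancel h g & cancel g h].

Definition minimal_map (X : topologicalType) (phi : X -> X) : Prop :=
  forall A : set X, closed A -> phi @` A = A -> A = set0 \/ A = setT.

Definition top_conj (X Y : topologicalType)
    (phi : X -> X) (psi : Y -> Y) : Prop :=
  exists2 h : X -> Y, homeomorphism h & h \o phi = psi \o h.

Lemma homeomorphism_image_clopen (X Y : topologicalType) (h : X -> Y)
    (A : set X) : homeomorphism h -> clopen A -> clopen (h @` A).
Proof.
move=> [_ [g [cg hg gh]]] clA.
suff -> : h @` A = g @^-1` A by exact: preimage_clopen.
apply/seteqP; split=> [_ [x Ax <-]|y Ay] /=; first by rewrite hg.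
by exists (g y).
Qed.

(* The countable Boolean algebra of clopen subsets of the Cantor space, with
   the discrete topology. *)
Definition clopen_algebra : Type :=
  discrete_topology (set_type (@clopen cantor_space)).

HB.instance Definition _ := Topological.on clopen_algebra.

Record cantor_homeo : Type := CantorHomeo {
  cantor_homeo_fun :> cantor_space -> cantor_space ;
  cantor_homeoP : homeomorphism cantor_homeo_fun }.

HB.instance Definition _ := gen_eqMixin cantor_homeo.
HB.instance Definition _ := gen_choiceMixin cantor_homeo.

Definition clopen_action (phi : cantor_homeo) (U : clopen_algebra) :
    clopen_algebra :=
  SigSub (mem_set
    (homeomorphism_image_clopen (cantor_homeoP phi) (set_mem (valP U)))).

(* The topology of pointwise convergence on the discrete clopen algebra,
   pulled back along the embedding phi |-> (U |-> phi @` U). *)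
HB.instance Definition _ := Topological.copy cantor_homeo
  (initial_topology
    (clopen_action : cantor_homeo -> {ptws clopen_algebra -> clopen_algebra})).

(* As a type, this carries the subspace topology of [cantor_homeo]; [borel] of
   it is therefore the trace of the Borel structure of [cantor_homeo]. *)
Definition minimal_homeos : set cantor_homeo := [set phi | minimal_map phi].

Definition conj_minimal (phi psi : minimal_homeos) : Prop :=
  top_conj (set_val phi) (set_val psi).

Definition same_range (R : realType) (x y : {ptws nat -> R}) : Prop :=
  range x = range y.
Arguments same_range : clear implicits.

(* Main.v *)
(* For a real r let d(r) be a 3-adic number whose digits 0 and 1 record, each
   infinitely often, the truth values of q < r for q rational; as no digit is 2,
   d(r) - d(s) is an integer only for r = s, and d(r) is never an integer.  A
   sequence x of reals is sent to the orbit closure X_x of the Z-indexed word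
   which at k lists all residues of k modulo powers of 3, the parity of the
   3-adic valuation of k - d(x_i) for every i, and the valuation modulo 3 of
   k - m for a fixed marker m = ...111.  This word is Toeplitz, so X_x is
   minimal, and X_x is an almost one-to-one extension of the 3-adic odometer:
   the fibres have three points over m + Z, two points over each d(x_i) + Z and
   one point elsewhere.

   A permutation or repetition of the x_i only relabels coordinates, so X_x
   depends on the range of x alone.  Conversely a conjugacy X_x -> X_y induces a
   translation of the odometer, since the difference of the odometer
   coordinates is continuous and invariant; the three-point fibres force this
   translation to be integral, and the two-point fibres then give the range.

   Reading a point of X_x at the successive nodes where the tree of X_x branches
   identifies X_x with the Cantor space in a way that is Borel in x. *)

From HB Require Import structures.
Require Import Defs.
From mathcomp Require Import all_boot all_order all_algebra.
From mathcomp Require Import all_classical all_reals all_analysis.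
Import numFieldNormedType.Exports.
From mathcomp Require Import zify ring lra.

Set Implicit Arguments.
Unset Strict Implicit.
Unset Printing Implicit Defensive.

Import Order.TTheory GRing.Theory Num.Theory.

Local Open Scope classical_set_scope.

(** * Cylinder neighbourhoods *)

Definition agree (n : nat) (u v : nat -> bool) : Prop :=
  forall i, (i < n)%N -> u i = v i.

Lemma agree_sym n u v : agree n u v -> agree n v u.
Proof. by move=> uv i /uv. Qed.

Lemma agree_trans n v u w : agree n u v -> agree n v w -> agree n u w.
Proof. by move=> uv vw i ilt; rewrite uv// vw. Qed.

Lemma agree_le m n u v : (m <= n)%N -> agree n u v -> agree m u v.
Proof. by move=> mn uv i im; apply: uv; exact: leq_trans mn. Qed.

Lemma agreeS n u v : agree n u v -> u n = v n -> agree n.+1 u v.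
Proof. by move=> uv un i; rewrite ltnS leq_eqVlt => /predU1P[->//|/uv]. Qed.

Lemma agree_eq (u v : nat -> bool) : (forall n, agree n u v) -> u = v.
Proof. by move=> uv; apply/funext => n; exact: (uv n.+1). Qed.

(** The sets [B s] generate a filter, and convergence of this filter to [g] in the supremum topology
    can be tested one coordinate at a time. *)
Lemma nbhs_ptws (I : choiceType) (T : topologicalType) (g : {ptws I -> T})
    (A : set {ptws I -> T}) : nbhs g A ->
  exists s : seq I, forall h, (forall i, i \in s -> h i = g i) -> A h.
Proof.
pose B (s : seq I) := [set h : {ptws I -> T} | forall i, i \in s -> h i = g i].
have FF : Filter (filter_from [set: seq I] B).
  apply: filter_from_filter; first by exists [::].
  by move=> s t _ _; exists (s ++ t) => // h hst; split=> i ii;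
    apply: hst; rewrite mem_cat ii ?orbT.
have Fg : filter_from [set: seq I] B --> g.
  apply/cvg_sup => i U [V [[W oW <-] Wgi WU]].
  exists [:: i] => // h hi; apply: WU.
  by have -> : ((fun f => f i) @^-1` W) h = W (h i) by [];
    rewrite hi ?inE.
by move=> /Fg[s _ sA]; exists s.
Qed.

Lemma nbhs_ptws_coord (I : eqType) (T : discreteTopologicalType)
    (g : {ptws I -> T}) (i : I) : nbhs g [set h : {ptws I -> T} | h i = g i].
Proof.
have := @proj_continuous I (fun=> T) i g [set g i] (discrete_set1 (g i)).
exact.
Qed.

Lemma near_forall_lt (T : Type) (F : set_system T) {FF : Filter F}
    (n : nat) (P : nat -> T -> Prop) :
  (forall i, (i < n)%N -> \forall y \near F, P i y) ->
  \forall y \near F, forall i, (i < n)%N -> P i y.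
Proof.
elim: n => [_|n IH FP]; first exact: nearW.
have Pn := FP n (ltnSn n).
have Plt : \forall y \near F, forall i, (i < n)%N -> P i y.
  by apply: IH => i /ltnW /FP.
apply: filterS2 Pn Plt => y Pny Plty i.
by rewrite ltnS leq_eqVlt => /predU1P[->|/Plty].
Qed.

Lemma nbhs_cantorP (w : cantor_space) (A : set cantor_space) :
  nbhs w A <-> exists n, forall u : cantor_space, agree n u w -> A u.
Proof.
split.
  move=> /(@nbhs_ptws nat bool)[s sA]; exists (\max_(i <- s) i).+1 => u uw.
  by apply: sA => i si; apply: uw; rewrite ltnS; exact: leq_bigmax_seq.
move=> [n nA]; apply: (@filterS _ (nbhs w) _ _ _ nA).
apply: (@near_forall_lt _ (nbhs w) _ n (fun i u => u i = w i)) => i _.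
exact: (@nbhs_ptws_coord nat bool w i).
Qed.

Lemma cantor_continuousP (T : topologicalType) (g : T -> cantor_space) :
  continuous g <-> forall t n, \forall u \near t, agree n (g u) (g t).
Proof.
split=> [gc t n|gc t A /nbhs_cantorP[n nA]].
  have gtn : nbhs (g t) [set v | agree n v (g t)].
    by apply/nbhs_cantorP; exists n.
  exact: (gc t _ gtn).
by have := gc t n; apply: filterS => u; exact: nA.
Qed.

Lemma cantor_cluster (s : nat -> cantor_space) :
  exists w : cantor_space,
    forall N m, exists2 n, (N <= n)%N & agree m (s n) w.
Proof.
have [w [_ ws]] := @cantor_space_compact (s @ \oo) _ filterT.
exists w => N m.
have [] := ws (s @` [set n | (N <= n)%N]) [set v | agree m v w].
- by exists N => // n /= Nn; exists n.
- by apply/nbhs_cantorP; exists m.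
- by move=> _ [[n Nn <-] nw]; exists n.
Qed.

Section locally_constant.
Context {T : topologicalType}.

Definition locally_constant (B : Type) (f : T -> B) : Prop :=
  forall t, \forall u \near t, f u = f t.

Lemma locally_constant_pair (B C : Type) (f : T -> B) (g : T -> C) :
  locally_constant f -> locally_constant g ->
  locally_constant (fun t => (f t, g t)).
Proof. by move=> fc gc t; apply: filterS2 (fc t) (gc t) => u -> ->. Qed.

Lemma locally_constant_coord (g : T -> cantor_space) (n : nat) :
  continuous g -> locally_constant (fun t => g t n).
Proof.
move=> /cantor_continuousP gc t; apply: filterS (gc t n.+1) => u; exact.
Qed.

Definition dense_family (I : Type) (e : I -> T) : Prop :=
  forall (y : T) (A : set T), nbhs y A -> exists i, A (e i).

Lemma dense_locally_constant (I B : Type) (e : I -> T) (f : T -> B)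
    (P : B -> Prop) :
  dense_family e -> locally_constant f ->
  (forall i, P (f (e i))) -> forall y, P (f y).
Proof. by move=> de fc Pe y; have [i <-] := de _ _ (fc y). Qed.

End locally_constant.

(** * Coding closed subsets of the Cantor space by branching nodes *)

Section coding.
Variable u : int -> cantor_space.

Definition orbit_closure (w : nat -> bool) : Prop :=
  forall n, exists k, agree n (u k) w.

(** The length-[n] prefix of [w] is a branching node of the tree of prefixes of the words [u k]. *)
Definition splits (w : nat -> bool) (n : nat) : Prop :=
  exists k l, [/\ agree n (u k) w, agree n (u l) w, u k n & ~~ u l n].

Fixpoint split_rank (w : nat -> bool) (n : nat) : nat :=
  if n is m.+1 then (split_rank w m + `[< splits w m >])%N else 0.

(** Bit [n] is the direction [w] takes at its branching node number [n], counted from 0; it defaults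
    to false if [w] meets no such node. *)
Definition tree_code (w : nat -> bool) : cantor_space := fun n =>
  `[< exists m, [/\ splits w m, split_rank w m = n & w m] >].

Lemma orbit_closure_orbit k : orbit_closure (u k).
Proof. by move=> n; exists k. Qed.

Lemma orbit_closure_closed (w : nat -> bool) :
  (forall n, exists2 v, orbit_closure v & agree n v w) -> orbit_closure w.
Proof.
move=> wX n; have [v vX vw] := wX n; have [k kv] := vX n.
by exists k; exact: agree_trans vw.
Qed.

Lemma splits_agree n v w : agree n v w -> splits v n -> splits w n.
Proof.
move=> vw [k [l [kv lv uk ul]]].
by exists k, l; split=> //; exact: agree_trans vw.
Qed.

Lemma split_rank_agree n v w : agree n v w -> split_rank v n = split_rank w n.
Proof.
elim: n => //= n IH vw; have vwn : agree n v w by exact: agree_le vw.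
rewrite IH//; congr (_ + nat_of_bool _)%N.
by apply/asbool_equiv_eq; split; apply: splits_agree => //; exact: agree_sym.
Qed.

Lemma split_rank_le w m n : (m <= n)%N -> (split_rank w m <= split_rank w n)%N.
Proof.
elim: n => [|n IH]; first by rewrite leqn0 => /eqP ->.
by rewrite leq_eqVlt => /predU1P[->//|/IH/leq_trans]; apply; exact: leq_addr.
Qed.

Lemma split_rank_inj w m n : splits w m -> splits w n ->
  split_rank w m = split_rank w n -> m = n.
Proof.
wlog : m n / (m < n)%N => [H|mn wm _ E].
  case: (ltngtP m n) => // mn wm wn E; first exact: H.
  by apply/esym/H.
have /asboolT {}wm := wm; have := split_rank_le w mn.
by rewrite /= wm E addn1 ltnn.
Qed.

Lemma tree_code_split_rank w m : splits w m -> tree_code w (split_rank w m) = w m.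
Proof.
move=> wm; rewrite /tree_code; case: (boolP (w m)) => [w1|w0].
  by apply/asboolP; exists m.
apply/asboolPn => -[k [wk /split_rank_inj km]].
by rewrite km//; apply/negP.
Qed.

Lemma tree_code_agree w m w' : splits w m -> agree m.+1 w' w ->
  tree_code w' (split_rank w m) = tree_code w (split_rank w m).
Proof.
move=> wm w'w; have w'wm : agree m w' w by exact: agree_le w'w.
rewrite (tree_code_split_rank wm) -(split_rank_agree w'wm) tree_code_split_rank ?w'w//.
exact: splits_agree (agree_sym w'wm) wm.
Qed.

Lemma splits_first_diff v w n : orbit_closure v -> orbit_closure w ->
  agree n v w -> v n <> w n -> splits w n.
Proof.
move=> vX wX vw; case: (boolP (v n)) => vn; case: (boolP (w n)) => wn// _;
  have [k kv] := vX n.+1; have [l lw] := wX n.+1.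
- exists k, l; rewrite kv// lw//; split=> //.
  + by apply: agree_trans vw; exact: agree_le kv.
  + exact: agree_le lw.
- exists l, k; rewrite kv// lw//; split=> //.
  + exact: agree_le lw.
  + by apply: agree_trans vw; exact: agree_le kv.
Qed.

(** At a first difference both words are at the same branching node, with the same rank, so their
    codes record the two different directions there. *)
Lemma tree_code_inj v w : orbit_closure v -> orbit_closure w ->
  tree_code v = tree_code w -> v = w.
Proof.
move=> vX wX vw; apply: agree_eq; elim=> [//|n IH]; apply: agreeS => //.
have [//|/eqP vwn] := eqVneq (v n) (w n).
have wn := splits_first_diff vX wX IH vwn.
have vn := splits_agree (agree_sym IH) wn.
by rewrite -(tree_code_split_rank wn) -vw -(split_rank_agree IH) tree_code_split_rank.
Qed.

Hypothesis no_isolated : forall k n, exists2 l, agree n (u l) (u k) & u l <> u k.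

(** Some [u l] other than [w] shares the first [n] bits of [w]; the place where the two first differ
    is a branching node. *)
Lemma splits_unbounded w n : orbit_closure w ->
  exists2 m, (n <= m)%N & splits w m.
Proof.
move=> wX.
have [l lw luw] : exists2 l, agree n (u l) w & u l <> w.
  have [k kw] := wX n; have [l lk luk] := no_isolated k n.
  have [kweq|kwneq] := pselect (u k = w); last by exists k.
  by exists l; rewrite -?kweq.
have ex_diff : exists m, u l m != w m.
  apply/not_existsP => H; apply: luw; apply/funext => m.
  by apply/eqP/negPn/negP; exact: H.
case: (ex_minnP ex_diff) => m /eqP lm mmin.
have lwm : agree m (u l) w.
  move=> i im; apply/eqP/negPn/negP => /mmin.
  by rewrite leqNgt im.
exists m; last first.
  by apply: splits_first_diff lwm lm => //; exact: orbit_closure_orbit.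
by rewrite leqNgt; apply/negP => /lw.
Qed.

Lemma next_split w n : orbit_closure w ->
  exists m, splits w m /\ split_rank w m = split_rank w n.
Proof.
move=> wX; have ex_split : exists m, (n <= m)%N && `[< splits w m >].
  have [m nm wm] := splits_unbounded n wX.
  by exists m; rewrite nm; apply/asboolP.
case: (ex_minnP ex_split) => m /andP[nm /asboolP wm] mmin; exists m; split=> //.
rewrite -(subnKC nm); have : (m - n <= m - n)%N by [].
elim: {1 3}(m - n)%N => [|i IH] im; first by rewrite addn0.
rewrite addnS /= IH; last exact: ltnW.
have /asboolPn/negbTE-> : ~ splits w (n + i)%N; last by rewrite addn0.
move=> /asboolP wi; have := mmin (n + i)%N; rewrite wi leq_addr => /(_ isT).
by rewrite leqNgt -ltn_subRL im.
Qed.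

Lemma split_rank_surj w n : orbit_closure w ->
  exists2 m, splits w m & split_rank w m = n.
Proof.
move=> wX; elim: n => [|n [m wm <-]].
  by have [m [wm E]] := next_split 0 wX; exists m.
have [k [wk E]] := next_split m.+1 wX; exists k => //.
by rewrite E /= asboolT// addn1.
Qed.

(** Continuity of the code at points of the orbit closure: bit [n] depends only on the bits up to
    and including the branching node of rank [n]. The nearby [w'] may lie outside the closure. *)
Lemma tree_code_locally_constant w n : orbit_closure w ->
  exists m, forall w', agree m w' w -> agree n (tree_code w') (tree_code w).
Proof.
move=> wX; elim: n => [|n [m IH]]; first by exists 0%N.
have [k wk kn] := split_rank_surj n wX; exists (maxn m k.+1) => w' w'w.
apply: agreeS; first by apply: IH; exact: agree_le (leq_maxl _ _) w'w.
by rewrite -kn; apply: tree_code_agree => //; exact: agree_le (leq_maxr _ _) w'w.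
Qed.

(** By induction on the length of the prefix of [y]: at the branching node of rank [n] some [u l]
    takes the direction [y n], and the earlier bits of the code are read strictly before that
    node. *)
Lemma tree_code_orbit_dense : dense_family (fun k => tree_code (u k)).
Proof.
move=> y A /nbhs_cantorP[n nA].
suff [k ky] : exists k, agree n (tree_code (u k)) y by exists k; exact: nA.
elim: n {nA} => [|n [k IH]]; first by exists 0%R.
have [m km mn] := split_rank_surj n (orbit_closure_orbit k).
have [l lk ly] : exists2 l, agree m (u l) (u k) & u l m = y n.
  have [l1 [l0 [l1k l0k l1m l0m]]] := km.
  case: (boolP (y n)) => _; first by exists l1.
  by exists l0 => //; exact: negbTE.
exists l.
have lm := splits_agree (agree_sym lk) km.
have lmn : split_rank (u l) m = n by rewrite (split_rank_agree lk).
apply: agreeS; last by rewrite -lmn tree_code_split_rank// ly -lmn.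
suff /agree_trans : agree n (tree_code (u l)) (tree_code (u k)) by apply.
move=> i im; have [j kj ji] := split_rank_surj i (orbit_closure_orbit k).
rewrite -ji; apply: tree_code_agree => //; apply: agree_le lk.
rewrite ltnNge; apply/negP => /(split_rank_le (u k)).
by rewrite mn ji leqNgt im.
Qed.

(** Compactness: orbit points whose codes approximate [y] cluster at a point of the closure, and
    continuity of the code gives it the code [y]. *)
Lemma tree_code_surj (y : cantor_space) : exists w, orbit_closure w /\ tree_code w = y.
Proof.
have [s sy] : {s : nat -> int & forall n, agree n (tree_code (u (s n))) y}.
  apply: (@choice _ _ (fun n k => agree n (tree_code (u k)) y)) => n.
  apply: (@tree_code_orbit_dense y [set v | agree n v y]).
  by apply/nbhs_cantorP; exists n.
have [w ws] := cantor_cluster (u \o s).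
have wX : orbit_closure w.
  by move=> n; have [m _ mw] := ws 0%N n; exists (s m).
exists w; split=> //; apply/funext => i.
have [m mw] := tree_code_locally_constant i.+1 wX.
have [n ni nw] := ws i.+1 m.
by rewrite -(mw _ nw)//; exact: sy.
Qed.

Definition tree_decode (y : cantor_space) : cantor_space := projT1 (cid (tree_code_surj y)).

Lemma tree_decodeX y : orbit_closure (tree_decode y).
Proof. by have [] := projT2 (cid (tree_code_surj y)). Qed.

Lemma tree_decodeK : cancel tree_decode tree_code.
Proof. by move=> y; have [] := projT2 (cid (tree_code_surj y)). Qed.

Lemma tree_codeK w : orbit_closure w -> tree_decode (tree_code w) = w.
Proof.
move=> wX; apply: tree_code_inj => //; first exact: tree_decodeX.
by rewrite tree_decodeK.
Qed.

(** The inverse of a continuous bijection from a compact space. If it failed, decodings of points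
    tending to [y] would stay away from [tree_decode y], yet cluster at a point with code [y]. *)
Lemma tree_decode_continuous : continuous tree_decode.
Proof.
apply/cantor_continuousP => y n; apply/nbhs_cantorP; apply: contrapT => ncont.
have [s sy] : {s : nat -> cantor_space & forall m,
    agree m (s m) y /\ ~ agree n (tree_decode (s m)) (tree_decode y)}.
  apply: (@choice _ _ (fun m v => agree m v y /\
    ~ agree n (tree_decode v) (tree_decode y))) => m.
  apply: contrapT => nm; apply: ncont; exists m => v vy.
  by apply: contrapT => nv; apply: nm; exists v.
have [w ws] := cantor_cluster (tree_decode \o s).
have wX : orbit_closure w.
  apply: orbit_closure_closed => m; have [i _ iw] := ws 0%N m.
  by exists (tree_decode (s i)); first exact: tree_decodeX.
have wy : w = tree_decode y.
  apply: tree_code_inj => //; first exact: tree_decodeX.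
  rewrite tree_decodeK; apply/funext => i.
  have [m mw] := tree_code_locally_constant i.+1 wX.
  have [j ij jw] := ws i.+1 m.
  by rewrite -(mw _ jw)//= tree_decodeK; have [+ _] := sy j; apply.
have [i _ iw] := ws 0%N n.
by have [_] := sy i; apply; rewrite -wy.
Qed.

Lemma tree_code_comp_continuous (T : topologicalType) (g : T -> cantor_space) :
  continuous g -> (forall t, orbit_closure (g t)) ->
  continuous (fun t => tree_code (g t)).
Proof.
move=> /cantor_continuousP gc gX; apply/cantor_continuousP => t n.
have [m mt] := tree_code_locally_constant n (gX t).
by apply: filterS (gc t m) => s /mt.
Qed.

End coding.

(** * Maps between orbit closures, carried over to the Cantor space *)

Lemma orbit_closure_map (u v : int -> cantor_space)
    (F : cantor_space -> cantor_space) :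
  continuous F -> (forall k, exists l, F (u k) = v l) ->
  forall w : cantor_space, orbit_closure u w -> orbit_closure v (F w).
Proof.
move=> /cantor_continuousP Fc Fu w wX n.
have /nbhs_cantorP[m mF] := Fc w n.
have [k kw] := wX m; have [l E] := Fu k; exists l.
by rewrite -E; exact: mF.
Qed.

Section transport.
Variables u v : int -> cantor_space.
Hypothesis no_isolated_u :
  forall k n, exists2 l, agree n (u l) (u k) & u l <> u k.
Hypothesis no_isolated_v :
  forall k n, exists2 l, agree n (v l) (v k) & v l <> v k.

Definition transport (F : cantor_space -> cantor_space) (y : cantor_space) :
  cantor_space := tree_code v (F (tree_decode no_isolated_u y)).

Variable F : cantor_space -> cantor_space.
Hypothesis F_continuous : continuous F.
Hypothesis FX : forall w : cantor_space, orbit_closure u w -> orbit_closure v (F w).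

Lemma transport_continuous : continuous (transport F).
Proof.
apply: (tree_code_comp_continuous no_isolated_v (g := F \o tree_decode no_isolated_u)).
  by move=> y; apply: continuous_comp; [exact: tree_decode_continuous|exact: F_continuous].
by move=> y; apply: FX; exact: tree_decodeX.
Qed.

Lemma tree_decode_transport y :
  tree_decode no_isolated_v (transport F y) = F (tree_decode no_isolated_u y).
Proof. by rewrite tree_codeK//; apply: FX; exact: tree_decodeX. Qed.

End transport.

Lemma transport_homeomorphism (u v : int -> cantor_space)
    (ui : forall k n, exists2 l, agree n (u l) (u k) & u l <> u k)
    (vi : forall k n, exists2 l, agree n (v l) (v k) & v l <> v k)
    (F G : cantor_space -> cantor_space) :
  continuous F -> continuous G ->
  (forall w : cantor_space, orbit_closure u w -> orbit_closure v (F w)) ->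
  (forall w : cantor_space, orbit_closure v w -> orbit_closure u (G w)) ->
  (forall w, orbit_closure u w -> G (F w) = w) ->
  (forall w, orbit_closure v w -> F (G w) = w) ->
  homeomorphism (transport v ui F).
Proof.
move=> Fc Gc FX GX FK GK; split; first exact: transport_continuous.
exists (transport u vi G); split; first exact: transport_continuous.
- move=> y; rewrite {1}/transport tree_decode_transport// FK ?tree_decodeK//.
  exact: tree_decodeX.
- move=> y; rewrite {1}/transport tree_decode_transport// GK ?tree_decodeK//.
  exact: tree_decodeX.
Qed.

(** * Toeplitz subshifts *)

Section reindexing.
Variable J : countType.

(** Numbers that code no element of [J] are fixed, so that identities and compositions lift. *)
Definition lift_index (phi : J -> J) (n : nat) : nat :=
  if pickle_inv n is Some x then pickle (phi x) else n.

Lemma lift_index_pickle (phi : J -> J) x : lift_index phi (pickle x) = pickle (phi x).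
Proof. by rewrite /lift_index pickleK_inv. Qed.

Lemma lift_index_id (phi : J -> J) : phi =1 id -> lift_index phi =1 id.
Proof.
move=> phi_id n; rewrite /lift_index.
case E : (pickle_inv n) => [x|//].
by have := @pickle_invK J n; rewrite E /= phi_id.
Qed.

Lemma lift_index_comp (phi psi : J -> J) n :
  lift_index phi (lift_index psi n) = lift_index (phi \o psi) n.
Proof.
rewrite {2 3}/lift_index; case E : (pickle_inv n) => [x|].
  by rewrite lift_index_pickle.
by rewrite /lift_index E.
Qed.

Lemma eq_lift_index (phi psi : J -> J) : phi =1 psi ->
  lift_index phi =1 lift_index psi.
Proof.
by move=> E n; rewrite /lift_index; case: pickle_inv => [x|//]; rewrite E.
Qed.

Definition reindex (phi : J -> J) (w : cantor_space) : cantor_space :=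
  w \o lift_index phi.

Lemma reindex_continuous phi : continuous (reindex phi).
Proof.
apply/cantor_continuousP => w n; apply/nbhs_cantorP.
exists (\max_(i < n) lift_index phi i).+1 => v vw i ilt; apply: vw.
by rewrite ltnS (leq_bigmax (Ordinal ilt)).
Qed.

Lemma reindexK (phi psi : J -> J) : cancel psi phi ->
  cancel (reindex phi) (reindex psi).
Proof.
move=> K w; apply/funext => n; rewrite /reindex /= lift_index_comp.
by rewrite lift_index_id.
Qed.

Definition points_of (I : Type) (W : I -> J -> bool) (i : I) : cantor_space :=
  fun n => if pickle_inv n is Some x then W i x else false.

Lemma points_of_pickle (I : Type) (W : I -> J -> bool) i x :
  points_of W i (pickle x) = W i x.
Proof. by rewrite /points_of pickleK_inv. Qed.

Lemma reindex_points_of (I I' : Type) (W : I -> J -> bool) (W' : I' -> J -> bool)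
    (phi : J -> J) i i' : (forall x, W i (phi x) = W' i' x) ->
  reindex phi (points_of W i) = points_of W' i'.
Proof.
move=> E; apply/funext => n; rewrite /reindex /= {2}/points_of /lift_index.
case En : (pickle_inv n) => [x|]; first by rewrite points_of_pickle.
by rewrite /points_of En.
Qed.

End reindexing.

Section subshift.
Variables (J : countType) (W : int -> J -> bool).

(** The period may depend on both the position and the coordinate, as for Toeplitz sequences. *)
Definition toeplitz : Prop := forall k j,
  exists2 P : nat, (0 < P)%N & forall i : int, W (k + i * P%:Z)%R j = W k j.

Definition separating : Prop := forall k l, W k =1 W l -> k = l.

(** The word seen from position [k], as a point of the Cantor space: coordinate [(l, j)] holds
    symbol [j] at distance [l]. *)
Definition orbit (k : int) : cantor_space :=
  points_of (fun k (x : int * J) => W (k + x.1)%R x.2) k.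

Lemma orbit_pickle k l j : orbit k (pickle (l, j)) = W (k + l)%R j.
Proof. exact: points_of_pickle. Qed.

Definition shift (e : int) : cantor_space -> cantor_space :=
  reindex (fun x : int * J => (x.1 + e, x.2)%R).

Lemma shift_orbit e k : shift e (orbit k) = orbit (k + e)%R.
Proof.
by apply: reindex_points_of => -[l j] /=; rewrite addrA addrAC.
Qed.

Lemma shift_pickle e w (l : int) (j : J) :
  shift e w (pickle (l, j)) = w (pickle (l + e, j)%R).
Proof. by rewrite /shift /reindex /= lift_index_pickle. Qed.

Lemma shiftK e : cancel (shift e) (shift (- e)%R).
Proof. by apply: reindexK => -[l j] /=; rewrite subrK. Qed.

Lemma shiftNK e : cancel (shift (- e)%R) (shift e).
Proof. by move=> w; have := shiftK (- e)%R w; rewrite opprK. Qed.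

Lemma shift_continuous e : continuous (shift e).
Proof. exact: reindex_continuous. Qed.

Lemma orbit_closure_shift e (w : cantor_space) :
  orbit_closure orbit w -> orbit_closure orbit (shift e w).
Proof.
apply: orbit_closure_map; first exact: shift_continuous.
by move=> k; exists (k + e)%R; exact: shift_orbit.
Qed.

Hypothesis Wt : toeplitz.
Hypothesis Ws : separating.

(** Finitely many coordinates have a common period, the product of their periods. *)
Lemma orbit_toeplitz k n : exists2 P : nat, (0 < P)%N &
  forall i : int, agree n (orbit (k + i * P%:Z)%R) (orbit k).
Proof.
elim: n => [|n [P P0 PE]]; first by exists 1%N.
have [Q Q0 QE] : exists2 Q : nat, (0 < Q)%N &
    forall i : int, orbit (k + i * Q%:Z)%R n = orbit k n.
  rewrite /orbit /points_of; case: (pickle_inv n) => [[l j]|]; last by exists 1%N.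
  have [Q Q0 QE] := Wt (k + l)%R j; exists Q => // i.
  by rewrite -(QE i) /= addrAC.
exists (P * Q)%N => [|i]; first by rewrite muln_gt0 P0.
apply: agreeS.
  by have := PE (i * Q%:Z)%R; rewrite -mulrA -PoszM mulnC.
by have := QE (i * P%:Z)%R; rewrite -mulrA -PoszM.
Qed.

Lemma orbit_inj : injective orbit.
Proof.
move=> k l kl; apply: Ws => j; have := orbit_pickle k 0 j.
by rewrite kl orbit_pickle !addr0.
Qed.

(** Moving by a common period keeps the prefix, while separation makes the new point different. *)
Lemma orbit_no_isolated k n :
  exists2 l, agree n (orbit l) (orbit k) & orbit l <> orbit k.
Proof.
have [P P0 PE] := orbit_toeplitz k n; exists (k + P%:Z)%R.
  by have := PE 1%R; rewrite mul1r.
by move=> /orbit_inj; lia.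
Qed.

Local Notation dec := (tree_decode orbit_no_isolated).

Definition subshift_map : cantor_space -> cantor_space :=
  transport orbit orbit_no_isolated (shift 1).

Lemma subshift_map_homeomorphism : homeomorphism subshift_map.
Proof.
apply: (@transport_homeomorphism _ _ _ orbit_no_isolated _ (shift (- 1)%R)).
- exact: shift_continuous.
- exact: shift_continuous.
- exact: orbit_closure_shift.
- exact: orbit_closure_shift.
- by move=> w _; exact: shiftK.
- by move=> w _; exact: shiftNK.
Qed.

Lemma tree_decode_subshift_map y : dec (subshift_map y) = shift 1 (dec y).
Proof. by apply: tree_decode_transport; exact: orbit_closure_shift. Qed.

Lemma tree_decode_orbit k : dec (tree_code orbit (orbit k)) = orbit k.
Proof. by rewrite tree_codeK//; exact: orbit_closure_orbit. Qed.

Lemma subshift_map_orbit k :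
  subshift_map (tree_code orbit (orbit k)) = tree_code orbit (orbit (k + 1)%R).
Proof. by rewrite /subshift_map /transport tree_decode_orbit shift_orbit. Qed.

Lemma iter_subshift_map_orbit i k :
  iter i subshift_map (tree_code orbit (orbit k)) = tree_code orbit (orbit (k + i%:Z)%R).
Proof.
elim: i => [|i /= ->]; first by rewrite addr0.
rewrite subshift_map_orbit; congr (tree_code _ (orbit _)); lia.
Qed.

Lemma iter_continuous (T : topologicalType) (f : T -> T) i :
  continuous f -> continuous (iter i f).
Proof.
move=> fc; elim: i => [|i IH] x; first exact: cvg_id.
by apply: (@continuous_comp _ _ _ (iter i f) f); [exact: IH|exact: fc].
Qed.

(** Any cylinder around [z] contains a coded orbit point [k], and the positions congruent to [k]
    modulo some [P] also land in it. Hence every point [y] enters the cylinder within [P] steps, and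
    an invariant closed set containing [y] must contain [z]. *)
Lemma subshift_map_minimal : minimal_map subshift_map.
Proof.
move=> A Acl fA; have [->|/set0P[y Ay]] := eqVneq A set0; [by left|right].
apply/seteqP; split=> // z _; apply: contrapT => Az.
have /nbhs_cantorP[n nA] : nbhs z (~` A).
  by apply: open_nbhs_nbhs; split=> //; exact: closed_openC.
have [k kz] : exists k, agree n (tree_code orbit (orbit k)) z.
  apply: (@tree_code_orbit_dense _ orbit_no_isolated z [set v | agree n v z]).
  by apply/nbhs_cantorP; exists n.
have [m mk] := tree_code_locally_constant orbit_no_isolated n
  (orbit_closure_orbit orbit k).
have [P P0 PE] := orbit_toeplitz k m.
have fc : continuous subshift_map by have [] := subshift_map_homeomorphism.
(* An orbit point this close to [y] shadows it for [P] steps, which covers every residue modulo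
   [P]. *)
have : \forall y' \near y, forall i, (i < P)%N ->
    agree n (iter i subshift_map y') (iter i subshift_map y).
  apply: (@near_forall_lt _ (nbhs y) _ P (fun i y' =>
    agree n (iter i subshift_map y') (iter i subshift_map y))) => i _.
  have /cantor_continuousP := @iter_continuous _ subshift_map i fc; exact.
move=> /(@tree_code_orbit_dense _ orbit_no_isolated)[l ly].
(* The number of steps after which position [l] becomes congruent to [k] modulo [P]. *)
pose i : nat := `|((k - l)%R %% Posz P)%Z|%N.
have iE : Posz i = ((k - l)%R %% Posz P)%Z by rewrite /i; lia.
have iP : (i < P)%N by rewrite /i; lia.
have iA : A (iter i subshift_map y).
  by elim: i {iE iP} => //= i IH; rewrite -fA; exists (iter i subshift_map y).
apply: nA iA; apply: agree_trans (agree_sym (ly i iP)) _.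
rewrite iter_subshift_map_orbit iE; apply: agree_trans kz; apply: mk.
have := PE (- ((k - l)%R %/ Posz P)%Z)%R; congr (agree _ (orbit _) _).
have := divz_eq (k - l)%R (Posz P); lia.
Qed.

End subshift.

(** * Borel predicates *)

Section borel_predicates.
Variable X : topologicalType.

Definition borel_pred (P : X -> Prop) : Prop := borel X [set x | P x].

Lemma borel_pred_ext (P Q : X -> Prop) :
  (forall x, P x <-> Q x) -> borel_pred P -> borel_pred Q.
Proof. by move=> PQ; have -> : P = Q by apply/predeqP. Qed.

Lemma borel_pred_not (P : X -> Prop) :
  borel_pred P -> borel_pred (fun x => ~ P x).
Proof.
move=> BP; move: BP => /sigma_algebraCD; rewrite setTD; exact.
Qed.

Lemma borel_pred_exists (I : countType) (P : I -> X -> Prop) :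
  (forall i, borel_pred (P i)) -> borel_pred (fun x => exists i, P i x).
Proof.
move=> BP; pose Q n x := if @unpickle I n is Some i then P i x else False.
apply: (@borel_pred_ext (fun x => exists n, Q n x)) => [x|].
  split=> [[n]|[i Pi]]; last by exists (pickle i); rewrite /Q pickleK.
  by rewrite /Q; case: unpickle => // i Pi; exists i.
rewrite /borel_pred.
have -> : [set x | exists n, Q n x] = \bigcup_n [set x | Q n x].
  by apply/seteqP; split=> x; [case=> n Qn; exists n|case=> n _ Qn; exists n].
apply: sigma_algebra_bigcup => n; rewrite /Q; case: unpickle => [i|].
  exact: BP.
exact: sigma_algebra0.
Qed.

Lemma borel_pred_forall (I : countType) (P : I -> X -> Prop) :
  (forall i, borel_pred (P i)) -> borel_pred (fun x => forall i, P i x).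
Proof.
move=> BP; apply: (@borel_pred_ext (fun x => ~ exists i, ~ P i x)) => [x|].
  split=> [H i|H [i]]; last exact.
  by apply: contrapT => nP; apply: H; exists i.
apply: borel_pred_not; apply: borel_pred_exists => i; exact: borel_pred_not.
Qed.

Lemma borel_pred_and (P Q : X -> Prop) :
  borel_pred P -> borel_pred Q -> borel_pred (fun x => P x /\ Q x).
Proof.
move=> BP BQ.
apply: (@borel_pred_ext (fun x => forall b : bool, if b then P x else Q x)).
  by move=> x; split=> [H|[Px Qx] []//]; split; [exact: H true|exact: H false].
by apply: borel_pred_forall => -[].
Qed.

Lemma borel_pred_impl (P Q : X -> Prop) :
  borel_pred P -> borel_pred Q -> borel_pred (fun x => P x -> Q x).
Proof.
move=> BP BQ; apply: (@borel_pred_ext (fun x => ~ (P x /\ ~ Q x))).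
  move=> x; split=> [H Px|H [Px]]; last by apply; exact: H.
  by apply: contrapT => nQ; exact: H.
apply: borel_pred_not; apply: borel_pred_and => //; exact: borel_pred_not.
Qed.

Lemma borel_pred_iff (P Q : X -> Prop) :
  borel_pred P -> borel_pred Q -> borel_pred (fun x => P x <-> Q x).
Proof. by move=> BP BQ; apply: borel_pred_and; exact: borel_pred_impl. Qed.

Lemma borel_pred_cst (P : Prop) : borel_pred (fun=> P).
Proof.
have [p|np] := pselect P.
  apply: (@borel_pred_ext (fun=> ~ False)) => [x|].
    by split=> // _ [].
  by apply: borel_pred_not; exact: sigma_algebra0.
apply: (@borel_pred_ext (fun=> False)) => [x|]; first by split=> // /np.
exact: sigma_algebra0.
Qed.

Lemma borel_pred_eqb (a b : X -> bool) :
  borel_pred a -> borel_pred b -> borel_pred (fun x => a x = b x).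
Proof.
move=> Ba Bb; apply: (@borel_pred_ext (fun x => a x <-> b x)).
  by move=> x; split=> [/Bool.eq_iff_eq_true//|->].
exact: borel_pred_iff.
Qed.

Lemma borel_pred_agree n (u v : X -> cantor_space) :
  (forall i, borel_pred (fun x => u x i)) ->
  (forall i, borel_pred (fun x => v x i)) ->
  borel_pred (fun x => agree n (u x) (v x)).
Proof.
move=> Bu Bv; apply: borel_pred_forall => i.
by apply: borel_pred_impl; [exact: borel_pred_cst|exact: borel_pred_eqb].
Qed.

(** An open set is the union of the cylinders it contains, and these are indexed by the countably
    many finite bit strings. *)
Lemma borel_pred_open (g : X -> cantor_space) (U : set cantor_space) :
  (forall i, borel_pred (fun x => g x i)) -> open U ->
  borel_pred (fun x => U (g x)).
Proof.
move=> Bg Uo.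
apply: (@borel_pred_ext (fun x => exists s : seq bool,
    (forall w : cantor_space, agree (size s) w (nth false s) -> U w) /\
    agree (size s) (g x) (nth false s))) => [x|].
  split=> [[s [sU /sU//]]|Ux].
  have /nbhs_cantorP[n nU] : nbhs (g x) U by exact: open_nbhs_nbhs.
  have gs : agree n (nth false (mkseq (g x) n)) (g x).
    by move=> i ilt; rewrite nth_mkseq.
  exists (mkseq (g x) n); rewrite size_mkseq; split=> [w ws|].
    by apply: nU; exact: agree_trans gs.
  exact: agree_sym.
apply: borel_pred_exists => s; apply: borel_pred_and; first exact: borel_pred_cst.
apply: (@borel_pred_agree _ g (fun=> nth false s)) => // i.
exact: borel_pred_cst.
Qed.

Variable u : X -> int -> cantor_space.
Hypothesis Bu : forall k i, borel_pred (fun x => u x k i).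

Lemma borel_pred_splits k n : borel_pred (fun x => splits (u x) (u x k) n).
Proof.
apply: borel_pred_exists => l; apply: borel_pred_exists => m.
apply: (@borel_pred_ext (fun x => (agree n (u x l) (u x k) /\
  agree n (u x m) (u x k)) /\ (u x l n /\ ~ u x m n))) => [x|].
  by split=> [[[? ?] [? /negP ?]]|[? ? ? /negP ?]].
apply: borel_pred_and; apply: borel_pred_and => //.
- exact: borel_pred_agree.
- exact: borel_pred_agree.
- exact: borel_pred_not.
Qed.

Lemma borel_pred_split_rank k n r :
  borel_pred (fun x => split_rank (u x) (u x k) n = r).
Proof.
elim: n r => [|n IH] r /=; first exact: borel_pred_cst.
apply: (@borel_pred_ext (fun x => exists b : bool,
  (split_rank (u x) (u x k) n + b)%N = r /\ (splits (u x) (u x k) n <-> b))).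
  move=> x; split=> [[b [<- /asbool_equiv_eq->]]|<-].
    by rewrite asboolb.
  exists `[<splits (u x) (u x k) n>]; split=> //.
  by split=> /asboolP.
apply: borel_pred_exists => b; apply: borel_pred_and; last first.
  by apply: borel_pred_iff; [exact: borel_pred_splits|exact: borel_pred_cst].
apply: (@borel_pred_ext (fun x => exists q : nat,
  (q + b)%N = r /\ split_rank (u x) (u x k) n = q)).
  by move=> x; split=> [[q [<- ->]]|<-]; last by eexists.
by apply: borel_pred_exists => q; apply: borel_pred_and => //; exact: borel_pred_cst.
Qed.

Lemma borel_pred_tree_code k n : borel_pred (fun x => tree_code (u x) (u x k) n).
Proof.
apply: (@borel_pred_ext (fun x => exists m, splits (u x) (u x k) m /\
   split_rank (u x) (u x k) m = n /\ u x k m)).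
  move=> x; split=> [[m [? [? ?]]]|/asboolP[m [? ? ?]]]; last by exists m.
  by apply/asboolP; exists m.
apply: borel_pred_exists => m; apply: borel_pred_and.
  exact: borel_pred_splits.
by apply: borel_pred_and => //; exact: borel_pred_split_rank.
Qed.

End borel_predicates.

(** * Borel maps into the space of minimal homeomorphisms *)

Lemma cantor_clopen_countable : countable (@clopen cantor_space).
Proof.
apply: clopen_countable; first exact: cantor_space_compact.
pose C (s : seq bool) := [set w : cantor_space | agree (size s) w (nth false s)].
exists (range C).
  by apply: (sub_countable (card_image_le _ _)); exact: countableP.
split.
  move=> _ [s _ <-]; rewrite openE => w ws; apply/nbhs_cantorP.
  by exists (size s) => v vw; exact: agree_trans ws.
move=> w A /nbhs_cantorP[n nA].
have ws : agree n w (nth false (mkseq w n)).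
  by move=> i ilt; rewrite nth_mkseq.
exists (C (mkseq w n)); first split.
- by exists (mkseq w n).
- by rewrite /C /= size_mkseq.
- move=> v; rewrite /C /= size_mkseq => vs; apply: nA.
  exact: agree_trans (agree_sym ws).
Qed.

Lemma clopen_algebra_enum : exists e : nat -> clopen_algebra,
  forall U, exists n, e n = U.
Proof.
have [E0|[g]] := pfcard_geP cantor_clopen_countable.
  by have : @clopen cantor_space setT by [exact: clopenT]; rewrite E0.
(* The surjection [g] has values in all sets; a value not known to be clopen is replaced by the
   whole space. *)
exists (fun n => if pselect (clopen (g n)) is left p then SigSub (mem_set p)
  else SigSub (mem_set (@clopenT cantor_space))) => U.
have [n _ gn] : (g @` setT) (set_val U).
  by apply: surj; exact: set_valP.
exists n; case: pselect => [p|[]]; first exact: val_inj.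
by rewrite gn; exact: set_valP.
Qed.

Lemma clopen_locally_constant (T : topologicalType) (A : set T) :
  clopen A -> locally_constant (fun t => `[< A t >]).
Proof.
move=> [oA cA] t; have [At|nAt] := pselect (A t).
  have : nbhs t A by exact: open_nbhs_nbhs.
  by apply: filterS => s As; rewrite !asboolT.
have : nbhs t (~` A) by apply: open_nbhs_nbhs; split=> //; exact: closed_openC.
by apply: filterS => s As; rewrite !asboolF.
Qed.

(** The condition says that [U] is the preimage of [V] under [phi]. Both are clopen, so they are
    equal once they agree on a dense family; for a countable family this is a countable
    condition. *)
Lemma clopen_action_dense (phi : cantor_homeo) (I : Type)
    (e : I -> cantor_space) (U V : clopen_algebra) : dense_family e ->
  clopen_action phi U = V <->
  forall i, set_val U (e i) <-> set_val V (phi (e i)).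
Proof.
move=> de; have [phic [psi [psic phiK psiK]]] := cantor_homeoP phi.
split=> [<- i|UV].
  split=> [Ue|]; first by exists (e i).
  by case=> z Uz /(can_inj phiK) <-.
have {}UV y : set_val U y <-> set_val V (phi y).
  have lc : locally_constant
      (fun y => (`[< set_val U y >], `[< set_val V (phi y) >])).
    apply: locally_constant_pair; apply: clopen_locally_constant.
      exact: set_valP.
    by apply: preimage_clopen => //; exact: set_valP.
  have /= H := dense_locally_constant (P := fun b => b.1 = b.2) de lc.
  have {}H : `[< set_val U y >] = `[< set_val V (phi y) >].
    by apply: H => i; exact/asbool_equiv_eq.
  by split=> /asboolP; [rewrite H|rewrite -H] => /asboolP.
apply: val_inj; apply/seteqP; split=> [_ [y /UV Vy <-]//|y Vy].
by exists (psi y); rewrite ?psiK//; apply/UV; rewrite psiK.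
Qed.

Lemma borel_map_minimal_homeos (X : topologicalType) (F : X -> minimal_homeos) :
  (forall U V : clopen_algebra,
    borel_pred (fun x => clopen_action (set_val (F x)) U = V)) ->
  borel_map F.
Proof.
move=> BF; have [e eP] := clopen_algebra_enum.
suff : borel minimal_homeos `<=` [set A | borel X (F @^-1` A)] by [].
apply: smallest_sub => [|_ [_ [G openG <-] <-]].
  split=> [|A BA|A BA]; rewrite /mkset.
  - by rewrite preimage_set0; exact: sigma_algebra0.
  - rewrite setTD preimage_setC; exact: borel_pred_not BA.
  - by rewrite preimage_bigcup; exact: sigma_algebra_bigcup.
change (borel X (F @^-1` (set_val @^-1` (clopen_action @^-1` G)))).
pose act x : {ptws clopen_algebra -> clopen_algebra} :=
  clopen_action (set_val (F x)).
have -> : F @^-1` (set_val @^-1` (clopen_action @^-1` G)) =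
    (* The list [t] codes a basic open set inside [G]: each pair of indices prescribes one value of
       the action. *)
    [set x | exists t : seq (nat * nat),
      (forall g : {ptws clopen_algebra -> clopen_algebra},
        (forall p, p \in t -> g (e p.1) = e p.2) -> G g) /\
      forall p : nat * nat, p \in t -> act x (e p.1) = e p.2].
  apply/seteqP; split=> [x Gx|x [t [tG xt]]]; last exact: tG.
  have /nbhs_ptws[s sG] : nbhs (act x) G by exact: open_nbhs_nbhs.
  pose pre U := projT1 (cid (eP U)).
  have preK U : e (pre U) = U by exact: projT2 (cid (eP U)).
  exists [seq (pre U, pre (act x U)) | U <- s]; split=> [g gt|].
    apply: sG => U Us; have := gt (pre U, pre (act x U)).
    by rewrite /= !preK; apply; exact: map_f.
  by move=> _ /mapP[U _ ->]; rewrite /= !preK.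
apply: borel_pred_exists => t; apply: borel_pred_and.
  exact: borel_pred_cst.
apply: borel_pred_forall => p; apply: borel_pred_impl.
  exact: borel_pred_cst.
exact: BF.
Qed.

(** * Triadic digits and the word of a sequence of reals *)

Local Open Scope ring_scope.

Local Notation dvd3 n k := (Posz (expn 3 n) %| k)%Z.

Lemma dvd3_le m n k : (m <= n)%N -> dvd3 n k -> dvd3 m k.
Proof. by move=> mn; apply: dvdz_trans; rewrite dvdzE dvdn_exp2l. Qed.

Lemma dvd3_small n k : (`|k| < 3 ^ n)%N -> dvd3 n k -> k = 0.
Proof.
move=> kn; rewrite dvdzE /= => kdiv; have [k0|k0] := posnP `|k|%N; first lia.
by have := dvdn_leq k0 kdiv; lia.
Qed.

Section triadic_digits.
Implicit Types d e : nat -> bool.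

(** The truncation to [n] digits of the 3-adic integer with digits [d], which represents it modulo
    3^n. *)
Fixpoint approx d (n : nat) : nat :=
  if n is m.+1 then (approx d m + d m * 3 ^ m)%N else 0%N.

Lemma approx_bound d n : (2 * approx d n < 3 ^ n)%N.
Proof. by elim: n => //= n IH; rewrite expnS; case: (d n); lia. Qed.

Lemma approx_mod d m n : (m <= n)%N -> dvd3 m (Posz (approx d n) - Posz (approx d m)).
Proof.
move=> /subnKC <-; elim: (n - m)%N => [|i IH]; first by rewrite addn0 subrr.
rewrite addnS /= PoszD addrAC rpredD//.
by rewrite dvdzE dvdn_mull// dvdn_exp2l// leq_addr.
Qed.

Lemma dvd3_approx_le d m n k : (m <= n)%N ->
  dvd3 n (k - Posz (approx d n)) -> dvd3 m (k - Posz (approx d m)).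
Proof.
move=> mn /(dvd3_le mn) kn.
have -> : k - Posz (approx d m) =
    (k - Posz (approx d n)) + (Posz (approx d n) - Posz (approx d m)) by lia.
by rewrite rpredD// approx_mod.
Qed.

(* Two digit strings without 2s whose 3-adic numbers differ by an integer [k]
   have truncations differing by less than 3^n, hence exactly by [k] once
   3^n > 2|k|. *)
Lemma approx_tail d e (k : int) :
  (forall n, dvd3 n (Posz (approx d n) - Posz (approx e n) - k)) ->
  exists N, forall n, (N <= n)%N -> d n = e n.
Proof.
move=> dek; have E n : (2 * `|k| < n)%N ->
    Posz (approx d n) - Posz (approx e n) = k.
  move=> kn; apply/eqP; rewrite -subr_eq0; apply/eqP.
  apply: dvd3_small (dek n).
  have := approx_bound d n; have := approx_bound e n.
  by have := @ltn_expl 3 n isT; lia.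
(* The truncations to [n] and to [n.+1] digits both differ by [k], so the digits added in between
   are equal. *)
exists (2 * `|k|).+1%N => n kn; have := E n kn; have := E n.+1 (ltnW kn).
by have := expn_gt0 3 n; rewrite /=; case: (d n); case: (e n) => //=; lia.
Qed.

(** The 3-adic valuation of [k - d] as a relation, since it is infinite when [d] is the integer
    [k]. *)
Definition valuation d (k : int) (n : nat) : bool :=
  dvd3 n (k - Posz (approx d n)) && ~~ dvd3 n.+1 (k - Posz (approx d n.+1)).

Definition non_integer d : Prop :=
  forall k : int, exists n, ~~ dvd3 n (k - Posz (approx d n)).

Lemma valuation_exists d k : non_integer d -> exists n, valuation d k n.
Proof.
move=> /(_ k) dk; case: (ex_minnP dk) => -[|n]; first by rewrite dvd1z.
move=> nk nmin; exists n; rewrite /valuation nk andbT.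
by apply/negPn/negP => /nmin; rewrite ltnn.
Qed.

Lemma valuation_inj d k m n : valuation d k m -> valuation d k n -> m = n.
Proof.
wlog : m n / (m < n)%N => [H|mn /andP[_ /negP km] /andP[kn _]].
  case: (ltngtP m n) => // mn vm vn; first exact: H.
  by apply/esym/H.
by case: km; exact: dvd3_approx_le kn.
Qed.

Lemma valuation_mod d k l n : dvd3 n.+1 (k - l) ->
  valuation d k n = valuation d l n.
Proof.
move=> kl; rewrite /valuation.
have E m : (m <= n.+1)%N ->
    dvd3 m (k - Posz (approx d m)) = dvd3 m (l - Posz (approx d m)).
  move=> mn; have -> : k - Posz (approx d m) = (k - l) + (l - Posz (approx d m)).
    by lia.
  by rewrite rpredDl//; exact: dvd3_le kl.
by rewrite !E.
Qed.

End triadic_digits.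

Section digits_of_reals.
Variable R : realType.
Implicit Types r s : R.

(* The exponent of 2 in [j] runs through all codes of rationals, each of them
   infinitely often. *)
Definition real_digits r (j : nat) : bool :=
  if @unpickle rat (logn 2 j) is Some q then ratr q < r else false.

Lemma real_digits_recurrent (q : rat) (N : nat) :
  exists2 n, (N <= n)%N & forall r, real_digits r n = (ratr q < r).
Proof.
(* The odd cofactor leaves the exponent of 2 equal to [pickle q] and pushes the index beyond [N]. *)
exists (2 ^ pickle q * (2 * N).+1)%N => [|r].
  by have := expn_gt0 2 (pickle q); nia.
rewrite /real_digits lognM ?expn_gt0// pfactorK// logn_coprime.
  by rewrite addn0 pickleK.
by rewrite coprime2n /= oddM.
Qed.

Lemma real_digits_true r N : exists2 n, (N <= n)%N & real_digits r n = true.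
Proof.
have /rat_in_itvoo[q] : r - 1 < r by lra.
rewrite in_itv /= => /andP[_ qr].
by have [n Nn nE] := real_digits_recurrent q N; exists n; rewrite ?nE.
Qed.

Lemma real_digits_false r N : exists2 n, (N <= n)%N & real_digits r n = false.
Proof.
have /rat_in_itvoo[q] : r < r + 1 by lra.
rewrite in_itv /= => /andP[qr _].
have [n Nn nE] := real_digits_recurrent q N; exists n => //.
by rewrite nE; apply/negbTE; rewrite -leNgt ltW.
Qed.

Lemma real_digits_tail_inj r s N :
  (forall n, (N <= n)%N -> real_digits r n = real_digits s n) -> r = s.
Proof.
wlog : r s / r < s => [H|rs].
  case: (ltgtP r s) => // rs E; first exact: H.
  by apply/esym/H => // n /E.
have /rat_in_itvoo[q] := rs; rewrite in_itv /= => /andP[rq qs] E.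
have [n Nn nE] := real_digits_recurrent q N.
by have := E n Nn; rewrite !nE qs ltNge (ltW rq).
Qed.

(** [None] stands for the marker ...111, that is the 3-adic number -1/2. *)
Definition label_digits (a : option R) : nat -> bool :=
  if a is Some r then real_digits r else xpredT.

Definition label_modulus (T : Type) (a : option T) : nat := if a is Some _ then 2 else 3.

Lemma label_digits_tail_inj (a b : option R) N :
  (forall n, (N <= n)%N -> label_digits a n = label_digits b n) -> a = b.
Proof.
case: a => [r|]; case: b => [s|]//= E.
- by rewrite (real_digits_tail_inj E).
- by have [n /E->] := real_digits_false r N.
- by have [n /E<-] := real_digits_false s N.
Qed.

(** An integral difference forces equal tails, hence equal labels; then [k] is divisible by every
    power of 3. *)
Lemma label_digits_shift (a b : option R) (k : int) :
  (forall n, dvd3 n (Posz (approx (label_digits a) n) -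
    Posz (approx (label_digits b) n) - k)) -> a = b /\ k = 0.
Proof.
move=> abk; have [N /label_digits_tail_inj ab] := approx_tail abk; split=> //.
have := abk `|k|%N; rewrite ab subrr sub0r rpredN => /dvd3_small; apply.
by rewrite ltn_expl.
Qed.

(** Compared with the zero string, an integer would force the digits to be eventually 0, but the
    digit 1 occurs infinitely often. *)
Lemma label_digits_non_integer (a : option R) : non_integer (label_digits a).
Proof.
move=> k; apply: contrapT => /forallNP H.
have a0 n : approx xpred0 n = 0%N by elim: n => //= n ->.
have [|N E] := @approx_tail (label_digits a) xpred0 k.
  move=> n; have /negP := H n; rewrite negbK => ka.
  by rewrite a0 subr0 -rpredN opprB.
have [n Nn an] : exists2 n, (N <= n)%N & label_digits a n = true.
  by case: a {H E} => [r|]; [exact: real_digits_true|exists N].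
by have := E n Nn; rewrite an.
Qed.

Definition valuation_class (a : option R) (k : int) (c : nat) : Prop :=
  exists n, valuation (label_digits a) k n /\ (n %% label_modulus a)%N = c.

Lemma valuation_class_exists a k :
  exists2 c, (c < label_modulus a)%N & valuation_class a k c.
Proof.
have [n an] := valuation_exists k (label_digits_non_integer a).
exists (n %% label_modulus a)%N; last by exists n.
by rewrite ltn_mod; case: a {an}.
Qed.

Lemma valuation_class_inj a k c c' :
  valuation_class a k c -> valuation_class a k c' -> c = c'.
Proof. by move=> [m [vm <-]] [n [vn <-]]; rewrite (valuation_inj vm vn). Qed.

(** If [k] is not congruent to the label modulo 3^n, the valuation is below [n] and is determined by
    [k] modulo 3^n. *)
Lemma valuation_class_mod a k l n c : dvd3 n (k - l) ->
  ~~ dvd3 n (k - Posz (approx (label_digits a) n)) ->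
  valuation_class a k c <-> valuation_class a l c.
Proof.
wlog suff H : k l / dvd3 n (k - l) ->
    ~~ dvd3 n (k - Posz (approx (label_digits a) n)) ->
    valuation_class a k c -> valuation_class a l c.
  move=> kl nk; split; first exact: H.
  apply: H; first by rewrite -rpredN opprB.
  have -> : l - Posz (approx (label_digits a) n) =
    (k - Posz (approx (label_digits a) n)) - (k - l) by lia.
  by rewrite rpredBr.
move=> kl nk [m [vm mc]]; exists m; split=> //.
rewrite -(valuation_mod _ (k := k))//; apply: dvd3_le kl.
rewrite ltnNge; apply/negP => nm; move/negP: nk; apply.
by case/andP: vm => + _; exact: dvd3_approx_le.
Qed.

(** [inl (n, r)] asks whether the position is [r] modulo 3^n; [inr (o, c)] asks whether the
    valuation at label [o] has residue [c], with [None] for the marker. One bit per question keeps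
    the alphabet Boolean. *)
Definition coordinate : Type := (nat * int + option nat * nat)%type.
HB.instance Definition _ := Countable.on coordinate.

Variable x : nat -> R.

Definition word (k : int) (j : coordinate) : bool :=
  match j with
  | inl (n, r) => dvd3 n (k - r)
  | inr (o, c) => `[< valuation_class (omap x o) k c >]
  end.

Lemma word_toeplitz : toeplitz word.
Proof.
move=> k [[n r]|[a c]].
  exists (3 ^ n)%N => [|i]; first by rewrite expn_gt0.
  by rewrite /= addrAC rpredDr// dvdz_mull.
have [n vn] := valuation_exists k (label_digits_non_integer (omap x a)).
exists (3 ^ n.+1)%N => [|i]; first by rewrite expn_gt0.
apply: asbool_equiv_eq; apply: iff_sym.
apply: (@valuation_class_mod _ _ _ n.+1); last by case/andP: vn.
by rewrite opprD addrA subrr sub0r rpredN dvdz_mull.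
Qed.

Lemma word_separating : separating word.
Proof.
move=> k l kl; have kl0 : k - l = 0.
  apply: (@dvd3_small `|k - l|%N); first by rewrite ltn_expl.
  by have := kl (inl (`|k - l|%N, l)); rewrite /= subrr dvdz0.
lia.
Qed.

End digits_of_reals.

(** * Fibres over the odometer *)

Section fibers.
Variables (R : realType) (x : nat -> R).

Definition in_subshift (w : cantor_space) : Prop :=
  orbit_closure (orbit (word x)) w.

(** The odometer coordinate of [w] modulo 3^n, given as the indicator of its residue class. *)
Definition phase (w : cantor_space) (n : nat) (r : int) : bool :=
  w (pickle (0 : int, inl (n, r) : coordinate)).

Definition same_phase (v w : cantor_space) : Prop :=
  forall n r, phase v n r = phase w n r.

(* The point of the odometer under [w], translated by [l], is the 3-adic number
   with digits [label_digits (omap x o)]. *)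
Definition singular (w : cantor_space) (o : option nat) (l : int) : Prop :=
  forall n, phase w n (Posz (approx (label_digits (omap x o)) n) - l).

Definition mark (w : cantor_space) (l : int) (o : option nat) (c : nat) : bool :=
  w (pickle (l, inr (o, c) : coordinate)).

(** Any finite part of a point of the subshift is read off the word at one position, so finitary
    facts about the word pass to all points. *)
Lemma in_subshift_word w (s : seq (int * coordinate)) : in_subshift w ->
  exists k, forall l j, (l, j) \in s -> w (pickle (l, j)) = word x (k + l) j.
Proof.
move=> wX; have [k kw] := wX (\max_(p <- s) pickle p).+1.
exists k => l j ljs; rewrite -orbit_pickle kw// ltnS.
exact: (@leq_bigmax_seq _ s xpredT pickle).
Qed.

Lemma phaseE w (l : int) n r : in_subshift w ->
  w (pickle (l, inl (n, r) : coordinate)) = phase w n (r - l).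
Proof.
move=> /(@in_subshift_word _ [:: (l, inl (n, r)); (0, inl (n, r - l))])[k kw].
rewrite /phase !kw ?inE ?eqxx ?orbT//= addr0; congr (_ %| _)%Z; lia.
Qed.

Lemma phase_eq w n r r' : in_subshift w -> phase w n r ->
  phase w n r' = dvd3 n (r - r').
Proof.
move=> /(@in_subshift_word _ [:: (0, inl (n, r)); (0, inl (n, r'))])[k kw].
rewrite /phase !kw ?inE ?eqxx ?orbT//= addr0 => kr.
have -> : r - r' = (k - r') - (k - r) by lia.
by rewrite [RHS]rpredBr.
Qed.

Lemma phase_exists w n : in_subshift w -> exists r, phase w n r.
Proof.
(* All residues modulo 3^n are inspected at once, so that one position [k] answers for them all. *)
pose s := [seq (0 : int, inl (n, Posz r) : coordinate) | r <- iota 0 (3 ^ n)].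
move=> /(@in_subshift_word _ s)[k kw].
have n0 : (0 < 3 ^ n)%N by rewrite expn_gt0.
pose r := `|(k %% Posz (3 ^ n))%Z|%N.
have rE : Posz r = (k %% Posz (3 ^ n))%Z by rewrite /r; lia.
exists (Posz r); rewrite /phase kw /=.
  rewrite addr0 rE {1}(divz_eq k (Posz (3 ^ n))) addrK.
  by rewrite dvdz_mull.
by apply: map_f; rewrite mem_iota /= add0n /r; lia.
Qed.

Lemma mark_eq w l o o' c : in_subshift w -> omap x o = omap x o' ->
  mark w l o c = mark w l o' c.
Proof.
move=> /(@in_subshift_word _ [:: (l, inr (o, c)); (l, inr (o', c))])[k kw] oo'.
by rewrite /mark !kw ?inE ?eqxx ?orbT//= oo'.
Qed.

Lemma mark_inj w l o c c' : in_subshift w ->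
  mark w l o c -> mark w l o c' -> c = c'.
Proof.
move=> /(@in_subshift_word _ [:: (l, inr (o, c)); (l, inr (o, c'))])[k kw].
rewrite /mark !kw ?inE ?eqxx ?orbT//=; exact: valuation_class_inj.
Qed.

Lemma mark_exists w l o : in_subshift w ->
  exists2 c, (c < label_modulus o)%N & mark w l o c.
Proof.
pose s := [seq (l, inr (o, c) : coordinate) | c <- iota 0 (label_modulus o)].
move=> /(@in_subshift_word _ s)[k kw].
have [c clt kc] := valuation_class_exists (omap x o) (k + l).
have {}clt : (c < label_modulus o)%N by case: (o) clt.
exists c => //; rewrite /mark kw; first exact/asboolP.
by apply: map_f; rewrite mem_iota.
Qed.

Lemma mark_same v w l o c : in_subshift v -> in_subshift w ->
  mark v l o c -> mark w l o c -> forall c', mark v l o c' = mark w l o c'.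
Proof.
move=> vX wX vc wc c'; apply/idP/idP => [vc'|wc'].
  by rewrite -(mark_inj vX vc vc').
by rewrite -(mark_inj wX wc wc').
Qed.

(** Away from a singular position, the phase modulo some 3^n already excludes the label, so it
    determines the valuation class. *)
Lemma mark_regular v w l o c : in_subshift v -> in_subshift w ->
  same_phase v w -> ~ singular v o l -> mark v l o c = mark w l o c.
Proof.
move=> vX wX vw /existsNP[n /negP vn].
have [r vr] := phase_exists n vX.
set a := Posz _ in vn.
pose s := [:: (0, inl (n, r)); (0, inl (n, a - l)); (l, inr (o, c))] :
  seq (int * coordinate).
have [k kv] := in_subshift_word s vX.
have [k' kw] := in_subshift_word s wX.
have wr : phase w n r by rewrite -vw.
move: vr wr vn; rewrite /phase /mark !kv ?inE ?eqxx ?orbT//.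
rewrite !kw ?inE ?eqxx ?orbT//= !addr0 => kr k'r ka.
apply: asbool_equiv_eq; apply: (@valuation_class_mod _ _ _ _ n).
  have -> : k + l - (k' + l) = (k - r) - (k' - r) by lia.
  by rewrite rpredB.
by have -> : k + l - a = k - (a - l) by lia.
Qed.

Lemma singular_same_phase v w o l :
  same_phase v w -> singular v o l -> singular w o l.
Proof. by move=> vw vs n; rewrite -vw. Qed.

Lemma singular_inj w o o' l l' : in_subshift w ->
  singular w o l -> singular w o' l' -> omap x o = omap x o' /\ l = l'.
Proof.
move=> wX wo wo'.
have [|-> /eqP] := @label_digits_shift _ (omap x o) (omap x o') (l - l').
  move=> n; have := wo' n; rewrite (phase_eq _ wX (wo n)).
  congr (_ %| _)%Z; lia.
by rewrite subr_eq0 => /eqP.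
Qed.

Lemma subshift_ext v w : in_subshift v -> in_subshift w ->
  (forall l j, v (pickle (l, j : coordinate)) = w (pickle (l : int, j))) ->
  v = w.
Proof.
move=> vX wX vw; apply/funext => n.
case E : (@pickle_inv (int * coordinate)%type n) => [[l j]|].
  by have := @pickle_invK (int * coordinate)%type n; rewrite E /= => <-.
have [k kv] := vX n.+1; have [k' kw] := wX n.+1.
by rewrite -kv// -kw// /orbit /points_of E.
Qed.

(** A point is singular at only one position and one label value, so every other coordinate is fixed
    by the phase. *)
Lemma singular_determined v w o l : in_subshift v -> in_subshift w ->
  same_phase v w -> singular v o l ->
  (forall c, mark v l o c = mark w l o c) -> v = w.
Proof.
move=> vX wX vw vs vwc; apply: subshift_ext => // l' [[n r]|[i c]].
  by rewrite !phaseE.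
have [vs'|nvs'] := pselect (singular v i l'); last exact: mark_regular.
have [oo' ll'] := singular_inj vX vs vs'.
change (mark v l' i c = mark w l' i c).
by rewrite -ll' -(mark_eq _ _ vX oo') -(mark_eq _ _ wX oo').
Qed.

Lemma singular_exists v w : in_subshift v -> in_subshift w ->
  same_phase v w -> v <> w -> exists o l, singular v o l.
Proof.
move=> vX wX vw vneqw; apply: contrapT => /forallNP H; apply: vneqw.
apply: subshift_ext => // l [[n r]|[i c]]; first by rewrite !phaseE.
by apply: mark_regular => // vs; apply: (H i); exists l.
Qed.

(** Distinct points in a fibre force a singular label. The label of a real allows only two marks,
    which by pigeonhole cannot separate three points, so the label is the marker. *)
Lemma three_point_fiber (w : nat -> cantor_space) :
  (forall c, in_subshift (w c)) ->
  (forall c c', same_phase (w c) (w c')) ->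
  (forall c c', (c < 3)%N -> (c' < 3)%N -> w c = w c' -> c = c') ->
  exists l, singular (w 0%N) None l.
Proof.
move=> wX ww winj.
have [||||i0 [l os]] := @singular_exists (w 0%N) (w 1%N).
- exact: wX.
- exact: wX.
- exact: ww.
- by move=> /winj; move=> /(_ isT isT).
case: i0 os => [i|] os; last by exists l.
have os' c : singular (w c) (Some i) l by exact: singular_same_phase os.
have weq c c' a : mark (w c) l (Some i) a -> mark (w c') l (Some i) a ->
    w c = w c'.
  move=> wc wc'; apply: (@singular_determined _ _ (Some i) l) => //.
  exact: (mark_same (wX c) (wX c') wc wc').
have [a0 a0lt w0] := mark_exists l (Some i) (wX 0%N).
have [a1 a1lt w1] := mark_exists l (Some i) (wX 1%N).
have [a2 a2lt w2] := mark_exists l (Some i) (wX 2%N).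
have : [|| a0 == a1, a0 == a2 | a1 == a2].
  by move: a0 a1 a2 a0lt a1lt a2lt {w0 w1 w2} => [|[|?]] [|[|?]] [|[|?]].
case/or3P => /eqP E.
- by move: w0; rewrite E => /weq /(_ w1) /winj; move=> /(_ isT isT).
- by move: w0; rewrite E => /weq /(_ w2) /winj; move=> /(_ isT isT).
- by move: w1; rewrite E => /weq /(_ w2) /winj; move=> /(_ isT isT).
Qed.

Lemma limit_point o c : (c < label_modulus o)%N ->
  exists w, [/\ in_subshift w, singular w o 0 & mark w 0 o c].
Proof.
move=> clt; set d := label_digits (omap x o).
pose m n := (n * label_modulus o + c)%N.
(* These integers tend to the label and have valuation exactly [m n], since 2 is never a digit of
   the label; [m n] has residue [c]. *)
pose k n : int := Posz (approx d (m n) + 2 * 3 ^ m n).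
have [w ws] := cantor_cluster (orbit (word x) \o k).
have wX : in_subshift w.
  by move=> n; have [i _ iw] := ws 0%N n; exists (k i).
exists w; split=> //.
- move=> n; rewrite /phase; set q := pickle _.
  have [i ni iw] := ws n q.+1.
  rewrite -(iw q)//= orbit_pickle /= addr0 subr0.
  apply: (@dvd3_approx_le _ _ (m i)).
    by apply: leq_trans ni _; rewrite /m; case: (o) => [?|] /=; lia.
  rewrite /k PoszD addrAC subrr add0r.
  by rewrite dvdzE dvdn_mull.
- rewrite /mark; set q := pickle _.
  have [i _ iw] := ws 0%N q.+1.
  rewrite -(iw q)//= orbit_pickle /= addr0; apply/asboolP.
  exists (m i); split; last first.
    have -> : label_modulus (omap x o) = label_modulus o by case: (o).
    by rewrite /m modnMDl modn_small.
  rewrite /valuation -/d /k; apply/andP; split.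
    by rewrite PoszD addrAC subrr add0r dvdzE dvdn_mull.
  apply/negP => /dvd3_small /=; rewrite expnS.
  have := expn_gt0 3 (m i); case: (d (m i)) => /=; lia.
Qed.

End fibers.

(** * The reduction *)

Section reduction.
Variable R : realType.
Implicit Types x y : nat -> R.

Definition word_map x : cantor_space -> cantor_space :=
  subshift_map (@word_toeplitz R x) (@word_separating R x).

Notation no_isolated x :=
  (orbit_no_isolated (@word_toeplitz R x) (@word_separating R x)).

Definition decode_word x : cantor_space -> cantor_space :=
  tree_decode (no_isolated x).

Lemma decode_word_subshift x z : in_subshift x (decode_word x z).
Proof. exact: tree_decodeX. Qed.

Lemma decode_word_map x z : decode_word x (word_map x z) =
  shift coordinate 1 (decode_word x z).
Proof. exact: tree_decode_subshift_map. Qed.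

Lemma decode_word_inj x : injective (decode_word x).
Proof. exact: can_inj (tree_decodeK (no_isolated x)). Qed.

Lemma phase_shift x w n r : in_subshift x w ->
  phase (shift coordinate 1 w) n r = phase w n (r - 1).
Proof. by move=> wX; rewrite {1}/phase shift_pickle add0r; exact: phaseE wX. Qed.

Lemma int_ind_iff (P : int -> Prop) :
  P 0 -> (forall k, P k <-> P (k + 1)) -> forall k, P k.
Proof.
move=> P0 PS; elim/int_ind => // n Pn.
  by have /PS := Pn; rewrite -addrC -intS.
by apply/PS; rewrite intS opprD addrC addrA subrr add0r.
Qed.

(** Along the orbit of [e 0] both phases advance by one per step, so their difference stays equal to
    [t]; density of the orbit and local constancy extend this to every [z]. *)
Lemma conjugacy_translates_phase x y (h : cantor_space -> cantor_space) :
  continuous h -> h \o word_map x = word_map y \o h ->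
  forall n, exists t, forall z r,
    phase (decode_word x z) n r = phase (decode_word y (h z)) n (r + t).
Proof.
move=> hc hconj n; pose u := orbit (word x); pose e k := tree_code u (u k).
have decE k : decode_word x (e k) = u k by exact: tree_decode_orbit.
have eS k : word_map x (e k) = e (k + 1) by exact: subshift_map_orbit.
have [t te] := phase_exists n (decode_word_subshift y (h (e 0))).
exists t => z r.
have E k r' : phase (decode_word x (e k)) n r' =
    phase (decode_word y (h (e k))) n (r' + t).
  move: k r'; apply: int_ind_iff => [r'|k].
    rewrite (phase_eq _ (decode_word_subshift y _) te).
    rewrite decE (@phase_eq _ x _ _ 0); last 2 first.
    - exact: orbit_closure_orbit.
    - by rewrite /phase /u orbit_pickle /= addr0 subrr dvdz0.
    by rewrite opprD addrCA subrr addr0 sub0r.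
  have hS : decode_word y (h (e (k + 1))) =
      shift coordinate 1 (decode_word y (h (e k))).
    rewrite -eS; have /(congr1 (fun f => f (e k))) /= -> := hconj.
    exact: decode_word_map.
  rewrite hS -eS decode_word_map.
  split=> H r'.
    rewrite (phase_shift _ _ (decode_word_subshift x _)).
    rewrite (phase_shift _ _ (decode_word_subshift y _)) H.
    by congr phase; lia.
  have := H (r' + 1); rewrite (phase_shift _ _ (decode_word_subshift x _)).
  rewrite (phase_shift _ _ (decode_word_subshift y _)) addrK => ->.
  by congr phase; lia.
have de : dense_family e by exact: tree_code_orbit_dense (no_isolated x).
have dx : continuous (decode_word x) by exact: tree_decode_continuous.
have dy : continuous (fun z => decode_word y (h z)).
  move=> z'; apply: (@continuous_comp _ _ _ h (decode_word y)); first exact: hc.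
  exact: tree_decode_continuous.
have lc := locally_constant_pair
  (locally_constant_coord (pickle (0 : int, inl (n, r) : coordinate)) dx)
  (locally_constant_coord (pickle (0 : int, inl (n, r + t) : coordinate)) dy).
have /= := dense_locally_constant (P := fun b => b.1 = b.2) de lc.
by apply => k; exact: E.
Qed.

(** The three points over the marker show that the translation is the integer [- l]. The two points
    over the label of [x i] then map to points singular at a label of [y] that differs from it by an
    integer, hence equals it. *)
Lemma conjugacy_sub_range x y : top_conj (word_map x) (word_map y) ->
  forall i, exists j, x i = y j.
Proof.
move=> [h [hc [h' [_ hK _]]] hconj] i.
have tr := conjugacy_translates_phase hc hconj.
pose g z := decode_word y (h z).
have ginj : injective g by move=> z z' /decode_word_inj /(can_inj hK).
have gX z : in_subshift y (g z) by exact: decode_word_subshift.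
have g_phase z z' : same_phase (decode_word x z) (decode_word x z') ->
    same_phase (g z) (g z').
  move=> zz' n r; have [t tE] := tr n.
  by have := zz' n (r - t); rewrite !tE subrK.
have lim o c : (c < label_modulus o)%N -> exists z,
    singular x (decode_word x z) o 0 /\ mark (decode_word x z) 0 o c.
  move=> /(limit_point x)[w [wX ws wc]].
  exists (tree_code (orbit (word x)) w).
  by rewrite /decode_word tree_codeK.
have sing_phase o z z' : singular x (decode_word x z) o 0 ->
    singular x (decode_word x z') o 0 ->
    same_phase (decode_word x z) (decode_word x z').
  move=> zs zs' n r.
  by rewrite (phase_eq _ (decode_word_subshift x z) (zs n))
    (phase_eq _ (decode_word_subshift x z') (zs' n)).
have [l gl] : exists l, exists2 z, singular x (decode_word x z) None 0 &
    singular y (g z) None l.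
  have [z zE] : {z : nat -> cantor_space & forall c, (c < 3)%N ->
      singular x (decode_word x (z c)) None 0 /\
      mark (decode_word x (z c)) 0 None c}.
    apply: (@choice _ _ (fun c z => (c < 3)%N ->
      singular x (decode_word x z) None 0 /\ mark (decode_word x z) 0 None c)).
    move=> c; case: (ltnP c 3) => [/(lim None)[z zc]|]; last by exists (h point).
    by exists z.
  (* Only three points matter; larger indices repeat the point of index 0 to stay in the same
     fibre. *)
  pose w c := g (z (if (c < 3)%N then c else 0%N)).
  have [||c c' clt c'lt|l wl] := @three_point_fiber R y w.
  - by move=> c; exact: gX.
  - move=> c c'; apply: g_phase; apply: (sing_phase None).
      by case: ltnP => [/zE[]//|_]; have [] := zE 0%N isT.
    by case: ltnP => [/zE[]//|_]; have [] := zE 0%N isT.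
  - rewrite /w clt c'lt => /ginj E.
    have [_ zc] := zE _ clt; have [_ zc'] := zE _ c'lt.
    by move: zc; rewrite E => zc; exact: mark_inj (decode_word_subshift x _) zc zc'.
  by exists l; exists (z 0%N); [have [] := zE 0%N isT|].
(* Two points in the fibre over the label of [x i], told apart by the parity of the valuation. *)
have [z0 [z0s z0m]] := @lim (Some i) 0%N isT.
have [z1 [z1s z1m]] := @lim (Some i) 1%N isT.
have [i' [l' gl']] : exists o l, singular y (g z0) o l.
  apply: (singular_exists (gX z0) (gX z1)).
    by apply: g_phase; exact: sing_phase z0s z1s.
  move=> /ginj E; move: z0m; rewrite E => z0m.
  by have := mark_inj (decode_word_subshift x _) z0m z1m.
have [z zs gz] := gl.
have [|E _] := @label_digits_shift R (Some (x i)) (omap y i') (l - l').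
  (* Modulo 3^n the marker gives [t = - l]; substituting this in the relation for [z0] eliminates
     [t]. *)
  move=> n; have [t tE] := tr n.
  have := zs n; rewrite tE => zt.
  have := z0s n; rewrite tE => z0t.
  have := gz n; rewrite (phase_eq _ (gX z) zt) => tl.
  have := gl' n; rewrite (phase_eq _ (gX z0) z0t) => tl'.
  have := rpredB tl' tl; congr (_ %| _)%Z; rewrite /=; lia.
by case: i' E {gl'} => [j|]//= [xy]; exists j.
Qed.

Lemma top_conj_sym (T : topologicalType) (f g : T -> T) :
  top_conj f g -> top_conj g f.
Proof.
move=> [h [hc [h' [h'c hK h'K]]] hE]; exists h'; first by split=> //; exists h.
apply/funext => z; have /(congr1 (fun k => h' (k (h' z)))) /= := hE.
by rewrite hK h'K.
Qed.

(** * Equal ranges give conjugate systems *)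

Lemma orbit_closure_eq (u : int -> cantor_space)
    (f : cantor_space -> cantor_space) : continuous f ->
  (forall k, f (u k) = u k) -> forall w : cantor_space, orbit_closure u w -> f w = w.
Proof.
move=> /cantor_continuousP fc fu w wX; apply: agree_eq => n.
have /nbhs_cantorP[m mf] := fc w n.
have [k kw] := wX (maxn m n).
have kwm := agree_le (leq_maxl m n) kw; have kwn := agree_le (leq_maxr m n) kw.
by apply: agree_trans (agree_sym (mf _ kwm)) _; rewrite fu.
Qed.

Definition relabel (s : nat -> nat) (p : int * coordinate) : int * coordinate :=
  match p with
  | (l, inr (Some j, c)) => (l, inr (Some (s j), c))
  | _ => p
  end.

Lemma relabel_orbit x y s k : (forall j, x (s j) = y j) ->
  reindex (relabel s) (orbit (word x) k) = orbit (word y) k.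
Proof.
move=> xy; apply: reindex_points_of => -[l [[n r]|[[j|] c]]]//=.
by rewrite xy.
Qed.

Lemma relabel_closure x y s (w : cantor_space) : (forall j, x (s j) = y j) ->
  in_subshift x w -> in_subshift y (reindex (relabel s) w).
Proof.
move=> xy; apply: orbit_closure_map; first exact: reindex_continuous.
by move=> k; exists k; exact: relabel_orbit.
Qed.

(** The maps [s] and [s'] need not be mutually inverse: the composite fixes each orbit point because
    equal reals carry equal marks, and continuity extends this to the closure. *)
Lemma relabelK x y s s' (w : cantor_space) :
  (forall j, x (s j) = y j) -> (forall j, y (s' j) = x j) ->
  in_subshift x w -> reindex (relabel s') (reindex (relabel s) w) = w.
Proof.
move=> xy yx; apply: (@orbit_closure_eq _ (reindex (relabel s') \o reindex (relabel s))).
  move=> z; apply: (@continuous_comp _ _ _ (reindex (relabel s))).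
    exact: reindex_continuous.
  exact: reindex_continuous.
by move=> k /=; rewrite (relabel_orbit _ xy) (relabel_orbit _ yx).
Qed.

Lemma same_range_top_conj x y : range x = range y ->
  top_conj (word_map x) (word_map y).
Proof.
move=> xy.
have sub (a b : nat -> R) : range a = range b -> {s & forall j, a (s j) = b j}.
  move=> ab; apply: (@choice _ _ (fun j i => a i = b j)) => j.
  have : range a (b j) by rewrite ab; exists j.
  by move=> [i _ aij]; exists i.
have [s sE] := sub _ _ xy; have [s' s'E] := sub _ _ (esym xy).
exists (transport (orbit (word y)) (no_isolated x) (reindex (relabel s))).
  apply: (transport_homeomorphism (no_isolated x) (no_isolated y)
    (G := reindex (relabel s'))).
  - exact: reindex_continuous.
  - exact: reindex_continuous.
  - by move=> w; exact: relabel_closure.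
  - by move=> w; exact: relabel_closure.
  - by move=> w; exact: (relabelK sE s'E).
  - by move=> w; exact: (relabelK s'E sE).
have decE z : decode_word y
    (transport (orbit (word y)) (no_isolated x) (reindex (relabel s)) z) =
    reindex (relabel s) (decode_word x z).
  by apply: tree_decode_transport => w; exact: relabel_closure.
apply/funext => z; apply: (@decode_word_inj y).
(* The shift moves positions and the relabelling changes indices of reals, so the two commute. *)
rewrite /= decode_word_map !decE decode_word_map; apply/funext => n.
rewrite /shift /reindex /= !lift_index_comp; congr (decode_word x z _).
by apply: eq_lift_index => -[l [[m r]|[[j|] c]]].
Qed.

(** * Borel dependence of the system on the sequence *)

Lemma borel_pred_digits (o : option nat) j :
  borel_pred (fun x : {ptws nat -> R} => label_digits (omap x o) j).
Proof.
case: o => [i|] /=; last exact: borel_pred_cst.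
rewrite /real_digits; case: unpickle => [q|]; last exact: borel_pred_cst.
apply: sub_sigma_algebra.
apply: (@open_comp _ _ (fun x : {ptws nat -> R} => x i) [set r | ratr q < r]).
  by move=> x _; exact: (@proj_continuous nat (fun=> R) i x).
exact: open_gt.
Qed.

Lemma borel_pred_approx (o : option nat) n v :
  borel_pred (fun x : {ptws nat -> R} => approx (label_digits (omap x o)) n = v).
Proof.
elim: n v => [|n IH] v /=; first exact: borel_pred_cst.
apply: (@borel_pred_ext _ (fun x : {ptws nat -> R} => exists p : nat * bool,
    (p.1 + p.2 * 3 ^ n)%N = v /\
    (approx (label_digits (omap x o)) n = p.1 /\
     label_digits (omap x o) n = p.2))) => [x|].
  split=> [[[a b] /= [<- [-> ->]]]//|<-].
  by exists (approx (label_digits (omap x o)) n, label_digits (omap x o) n).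
apply: borel_pred_exists => p; apply: borel_pred_and.
  exact: borel_pred_cst.
apply: borel_pred_and; first exact: IH.
by apply: borel_pred_eqb; [exact: borel_pred_digits|exact: borel_pred_cst].
Qed.

Lemma borel_pred_dvd3 (o : option nat) (n m : nat) (k : int) :
  borel_pred (fun x : {ptws nat -> R} =>
    dvd3 n (k - Posz (approx (label_digits (omap x o)) m))).
Proof.
apply: (@borel_pred_ext _ (fun x : {ptws nat -> R} => exists v : nat,
    dvd3 n (k - Posz v) /\ approx (label_digits (omap x o)) m = v)) => [x|].
  split=> [[v [kv ->]]//|kx].
  by exists (approx (label_digits (omap x o)) m).
apply: borel_pred_exists => v; apply: borel_pred_and.
  exact: borel_pred_cst.
exact: borel_pred_approx.
Qed.

Lemma borel_pred_word k j : borel_pred (fun x : {ptws nat -> R} => word x k j).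
Proof.
case: j => [[n r]|[i c]] /=; first exact: borel_pred_cst.
apply: (@borel_pred_ext _ (fun x : {ptws nat -> R} =>
    exists n, (dvd3 n (k - Posz (approx (label_digits (omap x i)) n)) /\
      ~ dvd3 n.+1 (k - Posz (approx (label_digits (omap x i)) n.+1))) /\
    (n %% label_modulus i)%N = c)) => [x|].
  have -> : label_modulus i = label_modulus (omap x i) by case: i.
  split=> [[n [[n1 /negP n2] nc]]|/asboolP[n [/andP[n1 /negP n2] nc]]].
    by apply/asboolP; exists n; split=> //; apply/andP.
  by exists n.
apply: borel_pred_exists => n; apply: borel_pred_and.
  apply: borel_pred_and; first exact: borel_pred_dvd3.
  by apply: borel_pred_not; exact: borel_pred_dvd3.
exact: borel_pred_cst.
Qed.

Definition word_homeo x : cantor_homeo :=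
  CantorHomeo (subshift_map_homeomorphism (@word_toeplitz R x) (@word_separating R x)).

Lemma word_homeo_minimal x : minimal_homeos (word_homeo x).
Proof. exact: subshift_map_minimal. Qed.

Definition reduction (x : {ptws nat -> R}) : minimal_homeos :=
  SigSub (mem_set (@word_homeo_minimal x)).

(** On the coded dense orbit the map is the step from [k] to [k + 1], so sending [U] to [V] is a
    countable conjunction of conditions on the codes, which depend on [x] in a Borel way. *)
Lemma reduction_borel : borel_map reduction.
Proof.
apply: borel_map_minimal_homeos => U V.
pose e (x : {ptws nat -> R}) k := tree_code (orbit (word x)) (orbit (word x) k).
apply: (@borel_pred_ext _ (fun x : {ptws nat -> R} => forall k : int, set_val U (e x k) <->
    set_val V (e x (k + 1)))) => [x|].
  have de : dense_family (e x) by exact: tree_code_orbit_dense (no_isolated x).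
  apply: iff_sym; apply: iff_trans (clopen_action_dense _ U V de) _.
  have eS k : set_val (reduction x) (e x k) = e x (k + 1).
    exact: subshift_map_orbit.
  by split=> H k; have := H k; rewrite eS.
have Be k i : borel_pred (fun x : {ptws nat -> R} => e x k i).
  apply: (@borel_pred_tree_code _ (fun x : {ptws nat -> R} => orbit (word x))).
  move=> {}k {}i; rewrite /orbit /points_of.
  case: pickle_inv => [[l j]|]; first exact: borel_pred_word.
  exact: borel_pred_cst.
have [oU _] : clopen (set_val U) by exact: set_valP.
have [oV _] : clopen (set_val V) by exact: set_valP.
by apply: borel_pred_forall => k; apply: borel_pred_iff; apply: borel_pred_open.
Qed.

End reduction.

Theorem theorem1p1 (R : realType) :
  borel_reducible (same_range R) conj_minimal.
Proof.
exists (@reduction R) => [|x y]; first exact: reduction_borel.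
split=> [|xy]; first exact: same_range_top_conj.
have sub (a b : nat -> R) : (forall i, exists j, a i = b j) ->
    range a `<=` range b.
  by move=> ab _ [i _ <-]; have [j ->] := ab i; exists j.
apply/seteqP; split; apply: sub; apply: conjugacy_sub_range => //.
exact: top_conj_sym.
Qed.
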